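(* Let $R$ be a commutative ring with $1\neq 0$ and let $I$ be a weakly 1-absorbing primary ideal of $R$. If $\sqrt{I}$ is a maximal ideal of $R$, then $I$ is a primary ideal of $R$, and hence $I$ is a 1-absorbing primary ideal of $R$. In particular, if $I$ is a weakly 1-absorbing primary ideal of $R$ that is not a 1-absorbing primary ideal of $R$, then $\sqrt{I}$ is not a maximal ideal of $R$.
   Context: All rings are commutative with $1\neq 0$. For an ideal $I$ of $R$, $\sqrt{I}=\{a\in R : a^n\in I \text{ for some positive integer } n\}$. A proper ideal $I$ of $R$ is called weakly 1-absorbing primary if whenever $a,b,c\in R$ are nonunit elements and $0\neq abc\in I$, then $ab\in I$ or $c\in\sqrt{I}$. A proper ideal $I$ of $R$ is called 1-absorbing primary if whenever $a,b,c\in R$ are nonunit elements and $abc\in I$, then $ab\in I$ or $c\in\sqrt{I}$. *)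

(* Defs.v *)
(* MathComp, with the classical axioms of mathcomp.classical.boolp. *)
From mathcomp Require Import all_boot all_algebra.
From mathcomp Require Import boolp.

Set Implicit Arguments.
Unset Strict Implicit.
Unset Printing Implicit Defensive.

Import GRing.Theory.
Local Open Scope ring_scope.

(* Ideals are the boolean predicates [I : {pred R}] satisfying MathComp's
   [idealr_closed], which already includes properness ([1 \notin I]). Since
   boolp's [`[< _ >]] reflects any proposition, such predicates stand for
   arbitrary subsets of [R], not only decidable ones. *)

(* A [comNzRingType] does not come with the predicate [GRing.unit]. *)
Definition invertible (R : comNzRingType) (a : R) : Prop :=
  exists b : R, a * b = 1.

Definition radical (R : comNzRingType) (I : {pred R}) : {pred R} :=
  fun a => `[< exists2 n : nat, (0 < n)%N & a ^+ n \in I >].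

Definition maximal_ideal (R : comNzRingType) (J : {pred R}) : Prop :=
  idealr_closed J /\
  forall K : {pred R}, idealr_closed K -> {subset J <= K} -> K =i J.

Definition primary_ideal (R : comNzRingType) (I : {pred R}) : Prop :=
  idealr_closed I /\
  forall a b : R, a * b \in I -> a \in I \/ b \in radical I.

Definition one_absorbing_primary (R : comNzRingType) (I : {pred R}) : Prop :=
  idealr_closed I /\
  forall a b c : R, ~ invertible a -> ~ invertible b -> ~ invertible c ->
    a * b * c \in I -> a * b \in I \/ c \in radical I.

Definition weakly_one_absorbing_primary (R : comNzRingType) (I : {pred R}) :
    Prop :=
  idealr_closed I /\
  forall a b c : R, ~ invertible a -> ~ invertible b -> ~ invertible c ->
    a * b * c != 0 -> a * b * c \in I -> a * b \in I \/ c \in radical I.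

(* Main.v *)
(* If [a * b \in I] and [b] is not in the maximal ideal [radical I], then
   [1 - r * b] lies in [radical I] for some [r], so [(1 - r * b) ^+ n \in I] for
   some [n]. Since [a * (1 - r * b) ^+ n] is congruent to [a] modulo [a * b],
   this forces [a \in I]: [I] is primary, hence 1-absorbing primary. *)
Require Import Defs.
From mathcomp Require Import all_boot all_algebra.
From mathcomp Require Import boolp ring.

Set Implicit Arguments.
Unset Strict Implicit.
Unset Printing Implicit Defensive.

Import GRing.Theory.
Local Open Scope ring_scope.

(** Otherwise [M + Rb] would be a proper ideal containing [M], hence equal to [M] by maximality,
    although it contains [b]. *)
Lemma maximal_ideal_comaximal (R : comNzRingType) (M : {pred R}) (b : R) :
  maximal_ideal M -> b \notin M -> exists r : R, 1 - r * b \in M.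
Proof.
move=> [[M0 M1 Mlin] Mmax] bM; apply: contrapT => noinv.
(* [K] is [M + Rb]; [noinv] says exactly that [1] is not in [K], the properness required by
   [idealr_closed]. *)
pose K : {pred R} := fun x => `[< exists r, x - r * b \in M >].
have KP x : reflect (exists r, x - r * b \in M) (x \in K) by apply: asboolP.
have Kideal : idealr_closed K.
  split; first by apply/KP; exists 0; rewrite mul0r subr0.
    by apply/KP.
  move=> c u v /KP[r ru] /KP[s sv]; apply/KP; exists (c * r + s).
  have -> : c * u + v - (c * r + s) * b = c * (u - r * b) + (v - s * b) by ring.
  exact: Mlin.
have MK : {subset M <= K} by move=> x xM; apply/KP; exists 0; rewrite mul0r subr0.
by move/negP: bM; apply; rewrite -(Mmax K Kideal MK); apply/KP; exists 1;
  rewrite mul1r subrr.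
Qed.

Lemma primary_of_maximal_radical (R : comNzRingType) (I : {pred R}) :
  idealr_closed I -> maximal_ideal (radical I) -> primary_ideal I.
Proof.
move=> Iideal maxI; split=> // a b abI.
have [_ _ Ilin] := Iideal; have I0 : 0 \in I by case: Iideal.
have [|bI] := boolP (b \in radical I); [by right | left].
have [r /asboolP[n _ ynI]] := maximal_ideal_comaximal maxI bI.
set y := 1 - r * b in ynI.
(* Multiply by [a] the geometric sum identity [1 = y ^+ n + (1 - y) * \sum_(i < n) y ^+ i], where
   [1 - y = r * b]. The final [+ 0] gives both summands the shape [c * u + v] that [Ilin] expects,
   the inner one with [u = y ^+ n] and [v = 0]. *)
have -> : a = r * (\sum_(i < n) y ^+ i) * (a * b) + (a * y ^+ n + 0).
  have /eqP := subrX1 y n; rewrite subr_eq => /eqP ->.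
  by set S := \sum_(i < n) _; rewrite /y; ring.
by apply: (Ilin _ _ _ abI); apply: Ilin.
Qed.

Lemma primary_one_absorbing (R : comNzRingType) (I : {pred R}) :
  primary_ideal I -> one_absorbing_primary I.
Proof. by move=> [Iideal Iprim]; split=> // a b c _ _ _; apply: Iprim. Qed.

Theorem theorem2 (R : comNzRingType) (I : {pred R})
    (hI : weakly_one_absorbing_primary I) :
  (maximal_ideal (radical I) -> primary_ideal I /\ one_absorbing_primary I) /\
  (~ one_absorbing_primary I -> ~ maximal_ideal (radical I)).
Proof.
have prim : maximal_ideal (radical I) -> primary_ideal I.
  by case: hI => Iideal _; apply: primary_of_maximal_radical.
split=> [/prim pI | notabs /prim pI].
  by split=> //; apply: primary_one_absorbing.
exact/notabs/primary_one_absorbing.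
Qed.
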